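(* Consider contextual search with the symmetric loss $\ell(y,u)=|y-u|$. Let the learner run the following algorithm (Multiscale Steiner Potential): set $S_1=B$ and $z_i=2^{-i}/(8d)$ for all integers $i$; in each round $t=1,\dots,T$, after the adversary reveals $x_t$, let $i$ be the largest integer such that $\mathrm{width}(S_t;x_t)\le 2^{-i}$, and guess $y_t$ such that $$\mathrm{Vol}\big(\{v\in S_t+z_iB:\ \langle v,x_t\rangle\ge y_t\}\big)=\tfrac12\,\mathrm{Vol}(S_t+z_iB).$$ Then the total loss $\sum_{t=1}^T|y_t-\langle v_0,x_t\rangle|$ is $O(d\log d)$, where the implied constant is absolute (independent of $T$, $v_0$ and the adversary's choices).
   Context: Contextual search setting: $d\ge1$, $T\ge1$, and $B=\{v\in\mathbb{R}^d:\|v\|_2\le1\}$. A hidden vector $v_0\in B$ is fixed. In each round $t=1,\dots,T$ an adversary chooses $x_t\in B$, the learner chooses a guess $y_t\in\mathbb{R}$, incurs loss $\ell(y_t,\langle v_0,x_t\rangle)$, and receives feedback $\sigma_t\in\{-1,+1\}$, where $\sigma_t=+1$ if $y_t>\langle v_0,x_t\rangle$, $\sigma_t=-1$ if $y_t<\langle v_0,x_t\rangle$, and $\sigma_t$ is arbitrary if $y_t=\langle v_0,x_t\rangle$. The knowledge set is $S_t=\{v\in B:\ \sigma_\tau(y_\tau-\langle v,x_\tau\rangle)\ge0\text{ for all }\tau<t\}$ (so $S_1=B$). For a set $S$ and $x$, $\mathrm{width}(S;x)=\max_{v\in S}\langle v,x\rangle-\min_{v\in S}\langle v,x\rangle$.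 $S+zB=\{w+zu: w\in S,u\in B\}$ is the Minkowski sum and $\mathrm{Vol}$ is Lebesgue measure on $\mathbb{R}^d$.
   Formalization: For d = 1, where d log d = 0 and the literal bound fails, the total loss is bounded by an absolute constant instead; when width(S_t; x_t) = 0, so that no largest i exists, the guess y_t is the common value of <v, x_t> over v in S_t. *)

(* Defs.v *)
From mathcomp Require Import all_boot all_order all_algebra.
From mathcomp Require Import all_classical all_reals all_analysis.

Set Implicit Arguments.
Unset Strict Implicit.
Unset Printing Implicit Defensive.

Import Order.TTheory GRing.Theory Num.Theory.

Local Open Scope classical_set_scope.
Local Open Scope ring_scope.

Definition dot (R : realType) (d : nat) (u v : 'rV[R]_d) : R :=
  (u *m v^T) ord0 ord0.

(* The library norm `|v| on 'rV[R]_d is the sup norm, hence this definition. *)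
Definition norm2 (R : realType) (d : nat) (v : 'rV[R]_d) : R :=
  Num.sqrt (dot v v).

Definition unit_ball (R : realType) (d : nat) : set 'rV[R]_d :=
  [set v | norm2 v <= 1].

(* Lebesgue measure on R^n as the n-fold product of the one-dimensional one.
   The library's product \x is an integral of sections, so the value is
   meaningful on (product-)measurable sets only. *)
Fixpoint lebesgue_tuple (R : realType) (n : nat) :
    set (n.-tuple (measurableTypeR R)) -> \bar R :=
  match n return set (n.-tuple (measurableTypeR R)) -> \bar R with
  | 0 => dirac [tuple]
  | n'.+1 => pushforward
      (@lebesgue_measure R \x @lebesgue_tuple R n')%E
      (fun p : measurableTypeR R * n'.-tuple (measurableTypeR R) =>
         [tuple of p.1 :: p.2])
  end.

Definition volume (R : realType) (d : nat) (A : set 'rV[R]_d) : \bar R :=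
  lebesgue_tuple [set t | A (\row_i tnth t i)].

Definition minkowski_ball (R : realType) (d : nat) (S : set 'rV[R]_d) (z : R) :
    set 'rV[R]_d :=
  [set w + z *: u | w in S & u in @unit_ball R d].

(* Only used for nonempty compact S, where sup and inf are max and min. *)
Definition width (R : realType) (d : nat) (S : set 'rV[R]_d) (x : 'rV[R]_d) : R :=
  sup [set dot v x | v in S] - inf [set dot v x | v in S].

(* Rounds are numbered from 0. *)
Definition knowledge_set (R : realType) (d : nat) (x : nat -> 'rV[R]_d)
    (y sigma : nat -> R) (t : nat) : set 'rV[R]_d :=
  [set v | unit_ball v /\
    forall tau : nat, (tau < t)%N -> 0 <= sigma tau * (y tau - dot v (x tau))].

(* s is an admissible feedback to the guess y when the true value is u. *)
Definition valid_feedback (R : realType) (u y s : R) : Prop :=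
  [/\ s = 1 \/ s = -1, u < y -> s = 1 & y < u -> s = -1].

Definition largest_scale (R : realType) (d : nat) (S : set 'rV[R]_d)
    (x : 'rV[R]_d) (i : int) : Prop :=
  width S x <= 2 ^ (- i) /\
  forall j : int, width S x <= 2 ^ (- j) -> j <= i.

Definition scale_radius (R : realType) (d : nat) (i : int) : R :=
  2 ^ (- i) / (8 * d%:R).

(* When width S x = 0 every integer i satisfies width S x <= 2^-i and there is
   no largest one; then <v, x> has the same value for all v in S, so the
   learner knows it, and guesses it. *)
Definition msp_guess (R : realType) (d : nat) (S : set 'rV[R]_d)
    (x : 'rV[R]_d) (y : R) : Prop :=
  (width S x = 0 -> exists2 v : 'rV[R]_d, S v & y = dot v x) /\
  (width S x != 0 ->
    exists2 i : int, largest_scale S x i &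
      let K := minkowski_ball S (scale_radius R d i) in
      volume [set v | K v /\ y <= dot v x] = ((2^-1)%:E * volume K)%E).

(* Main.v *)
(** The potential of scale [i] is the volume of [S_t + z_i B]. Knowledge sets
    shrink, so it never increases; the point is that it drops by a constant
    factor whenever scale [i] is used. The set [S_(t+1) + z_i B] lies in a cut
    of [K = S_t + z_i B] by the halving hyperplane shifted by [z_i], which is
    at most a quarter of [width / d]. Instead of Brunn-Minkowski, the shifted
    cut is compared with the halving one by a single homothety of ratio
    [1 - O(1/d)], which multiplies volumes by a constant: this gives
    a factor [5/6]. As [K] contains a cube of side [2 z_i / d] and lies in one
    of side [2 (1 + z_i)], scale [i] is used [O(d (i + log d))] times, each
    time with loss [O(2^-i)]; it remains to sum a geometric series. *)

From HB Require Import structures.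
Require Import Defs.
From mathcomp Require Import all_boot all_order all_algebra.
From mathcomp Require Import all_classical all_reals all_analysis.
From mathcomp Require Import measurable_realfun ring lra.

Set Implicit Arguments.
Unset Strict Implicit.
Unset Printing Implicit Defensive.

Import Order.TTheory GRing.Theory Num.Theory numFieldNormedType.Exports.

Local Open Scope classical_set_scope.
Local Open Scope ring_scope.

(** * Lebesgue measure on tuples *)

Lemma measurable_tuple_cons (R : realType) n :
  measurable_fun setT (fun p : measurableTypeR R * n.-tuple (measurableTypeR R) =>
         [tuple of p.1 :: p.2]).
Proof. by apply: measurable_cons. Qed.

(** The diagonal products of two increasing exhaustions cover the product: a point caught at stages
    [n] and [k] is caught at stage [maxn n k]. *)
Lemma product_sigma_finite d1 d2 (T1 : measurableType d1) (T2 : measurableType d2)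
    (R : realType) (m1 : {sigma_finite_measure set T1 -> \bar R})
    (m2 : {sigma_finite_measure set T2 -> \bar R}) :
  sigma_finite setT (m1 \x m2)%E.
Proof.
have /sigma_finiteP[F [TF ndF Foo]] := sigma_finiteT m1.
have /sigma_finiteP[G [TG ndG Goo]] := sigma_finiteT m2.
exists (fun n => F n `*` G n).
  apply/esym; rewrite -subTset => -[x y] _.
  have [n _ Fnx] : (\bigcup_k F k) x by rewrite -TF.
  have [k _ Gky] : (\bigcup_k G k) y by rewrite -TG.
  exists (maxn n k) => //; split.
    by move: x Fnx; exact/subsetPset/ndF/leq_maxl.
  by move: y Gky; exact/subsetPset/ndG/leq_maxr.
move=> k; have [mF Fk] := Foo k; have [mG Gk] := Goo k.
split; first exact: measurableX.
by rewrite product_measure1E// lte_mul_pinfty// ge0_fin_numE.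
Qed.

(** The recursion yields a bare set function. Rewriting it to a bundled measure opens up measure
    theory, and sigma-finiteness carries the induction through the next product. *)
Lemma lebesgue_tuple_sigma_finite (R : realType) n :
  exists mu : {sigma_finite_measure set (n.-tuple (measurableTypeR R)) -> \bar R},
   @lebesgue_tuple R n = mu.
Proof.
elim: n => [|n [mu IH]].
  by exists (@dirac _ (0.-tuple (measurableTypeR R)) [tuple] R).
rewrite /= IH.
pose f := (fun p : measurableTypeR R * n.-tuple (measurableTypeR R) => [tuple of p.1 :: p.2]).
have mf : measurable_fun setT f := @measurable_tuple_cons R n.
pose nu := pushforward (@lebesgue_measure R \x mu)%E f.
have sf : sigma_finite setT nu.
  have [F FT Foo] := @product_sigma_finite _ _ _ _ R
    [the {sigma_finite_measure set _ -> \bar R} of @lebesgue_measure R] mu.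
  (* The inverse of [f] transports the exhaustion of the product to tuples. *)
  pose g := fun t : n.+1.-tuple (measurableTypeR R) => (thead t, [tuple of behead t]).
  have mg : measurable_fun setT g.
    apply/measurable_fun_pairP; split.
      exact: measurable_tnth.
    exact: measurable_behead.
  have gf p : g (f p) = p.
    by case: p => x t; rewrite /g /f /= theadE; congr (_, _); exact: val_inj.
  have fg A : f @^-1` (g @^-1` A) = A.
    by apply/seteqP; split => p; rewrite /preimage /= gf.
  exists (fun k => g @^-1` F k).
    by rewrite -preimage_bigcup -FT preimage_setT.
  move=> k; have [mFk Fk] := Foo k; split.
    by rewrite -[X in measurable X]setTI; apply: mg.
  by rewrite /nu /pushforward fg.
pose nu' : {sigma_finite_measure set (n.+1.-tuple (measurableTypeR R)) -> \bar R} :=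
  HB.pack nu (Measure_isSigmaFinite.Build _ _ _ nu sf).
by exists (nu' mf mf mf).
Qed.

(** Bundles the right-hand side of a change of variables as a measure, the form in which uniqueness
    theorems can compare it. *)
Lemma scaled_pushforward_measure d1 d2 (T1 : measurableType d1) (T2 : measurableType d2)
    (R : realType) (m : {measure set T1 -> \bar R}) (f : T1 -> T2) (r : R) :
  0 <= r -> measurable_fun setT f ->
  exists nu : {measure set T2 -> \bar R}, forall A, nu A = (r%:E * m (f @^-1` A))%E.
Proof.
move=> r0 mf; by unshelve eexists (mscale (NngNum r0) (pushforward m f)).
Qed.

Lemma measurable_affine1 (R : realType) (a r : R) :
  measurable_fun setT (fun x : measurableTypeR R => a + r * x : measurableTypeR R).
Proof.
apply: continuous_measurable_fun => x; apply: cvgD; first exact: cvg_cst.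
by apply: cvgMr; exact: cvg_id.
Qed.

(** By uniqueness: the right-hand side is a measure that agrees with Lebesgue measure on half-open
    intervals. *)
Lemma lebesgue_measure_affine (R : realType) (a r : R) (A : set (measurableTypeR R)) :
  0 < r -> measurable A ->
  lebesgue_measure A = (r%:E * lebesgue_measure ((fun x => a + r * x)%R @^-1` A))%E.
Proof.
move=> r0 mA; pose f := (fun x : measurableTypeR R => a + r * x : measurableTypeR R).
have mf : measurable_fun setT f := @measurable_affine1 R a r.
have [nu nuE] := scaled_pushforward_measure (@lebesgue_measure R) (ltW r0) mf.
rewrite -nuE; apply: (@lebesgue_measure_unique R nu) => // _ [[u v]] _ <-.
rewrite nuE.
have -> : f @^-1` `]u, v]%classic = (`](u - a) / r, (v - a) / r]%classic : set R).
  apply/seteqP; split => x; rewrite /f /preimage /= !in_itv /= ltr_pdivrMr// ler_pdivlMr//; lra.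
have lE : lebesgue_measure (`](u - a) / r, (v - a) / r]%classic : set R) =
    (if (u < v)%R then ((v - u) / r)%:E else 0)%E.
  rewrite lebesgue_measure_itv /= lte_fin ltr_pM2r ?invr_gt0// ltrD2r.
  case: ifP => _ //; rewrite -EFinB; congr (_%:E); field; rewrite gt_eqF//.
rewrite lebesgue_measure_itv /= lte_fin.
transitivity (r%:E * (if (u < v)%R then ((v - u) / r)%:E else 0))%E; last by rewrite -lE.
case: ifP => _; last by rewrite mule0.
by rewrite -EFinM -EFinB mulrC divfK ?gt_eqF.
Qed.

Definition affine_tuple (R : realType) n (a : 'I_n -> R) (r : R)
  (t : n.-tuple (measurableTypeR R)) : n.-tuple (measurableTypeR R) :=
  [tuple a i + r * tnth t i | i < n].

Lemma measurable_affine_tuple (R : realType) n (a : 'I_n -> R) (r : R) :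
  measurable_fun setT (affine_tuple a r).
Proof.
apply/measurable_fun_tnthP => i.
rewrite (_ : _ \o _ = fun t => a i + r * tnth t i); last first.
  by apply/funext => t /=; rewrite tnth_mktuple.
by apply: (measurableT_comp (measurable_affine1 (a i) r)); exact: measurable_tnth.
Qed.

(** By induction on the dimension: uniqueness of the product measure reduces the claim to
    rectangles, where each coordinate contributes one factor [r]. *)
Lemma lebesgue_tuple_affine (R : realType) n (a : 'I_n -> R) (r : R)
    (A : set (n.-tuple (measurableTypeR R))) :
  0 < r -> measurable A ->
  lebesgue_tuple A = ((r ^+ n)%:E * lebesgue_tuple (affine_tuple a r @^-1` A))%E.
Proof.
move=> r0; elim: n a A => [|n IH] a A mA.
  rewrite expr0 mul1e /=; congr (_ _); apply/seteqP.
  by split=> t; rewrite /preimage /= (tuple0 t) (tuple0 (affine_tuple _ _ _)).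
have [mu muE] := lebesgue_tuple_sigma_finite R n.
rewrite /= {1 2}/pushforward muE.
set c := fun p : measurableTypeR R * n.-tuple (measurableTypeR R) => [tuple of p.1 :: p.2].
have mc : measurable_fun setT c := @measurable_tuple_cons R n.
pose a' := fun i => a (lift ord0 i).
pose f := fun p : measurableTypeR R * n.-tuple (measurableTypeR R) =>
  ((a ord0 + r * p.1 : measurableTypeR R), affine_tuple a' r p.2).
have fc p : affine_tuple a r (c p) = c (f p).
  apply: eq_from_tnth => i; rewrite tnth_mktuple /c /f.
  case: (unliftP ord0 i) => [j|] -> /=; last by rewrite !tnth0.
  by rewrite !tnthS tnth_mktuple.
have mf : measurable_fun setT f.
  apply/measurable_fun_pairP; split.
    exact: (measurableT_comp (measurable_affine1 (a ord0) r)).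
  exact: (measurableT_comp (measurable_affine_tuple a' r)).
have rn : 0 <= r ^+ n.+1 by rewrite exprn_ge0// ltW.
have [nu nuE] := scaled_pushforward_measure (@lebesgue_measure R \x mu)%E rn mf.
have -> : c @^-1` (affine_tuple a r @^-1` A) = f @^-1` (c @^-1` A).
  by apply/seteqP; split => p; rewrite /preimage /= fc.
rewrite -nuE; apply: (product_measure_unique (m' := nu)).
  move=> B D mB mD; rewrite nuE /=.
  have -> : (@lebesgue_measure R \x mu)%E (f @^-1` (B `*` D)) =
      (@lebesgue_measure R ((fun x => a ord0 + r * x)%R @^-1` B) *
       mu (affine_tuple a' r @^-1` D))%E.
    apply: product_measure1E.
      by rewrite -[X in measurable X]setTI; apply: measurable_affine1.
    by rewrite -[X in measurable X]setTI; apply: measurable_affine_tuple.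
  rewrite (lebesgue_measure_affine (a ord0) r0 mB) -muE (IH a' D mD) exprS EFinM.
  by rewrite muleACA.
by rewrite -[X in measurable X]setTI; apply: mc.
Qed.

Lemma lebesgue_tuple_box (R : realType) n (a b : 'I_n -> R) :
  (forall i, a i <= b i) ->
  measurable [set t : n.-tuple (measurableTypeR R) | forall i, a i <= tnth t i <= b i] /\
  lebesgue_tuple [set t : n.-tuple (measurableTypeR R) | forall i, a i <= tnth t i <= b i] =
  (\prod_i (b i - a i))%:E.
Proof.
elim: n a b => [|n IH] a b ab.
  rewrite big_ord0 (_ : [set t | _] = setT); last by apply/seteqP; split => // t _ [].
  by rewrite /= diracT.
have [mu muE] := lebesgue_tuple_sigma_finite R n.
have [mB vB] := IH (fun i => a (lift ord0 i)) (fun i => b (lift ord0 i)) (fun i => ab _).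
split.
  rewrite (_ : [set t | _] = \bigcap_(i in [set: 'I_n.+1])
    ((fun t : n.+1.-tuple (measurableTypeR R) => tnth t i) @^-1` `[a i, b i])); last first.
    apply/seteqP; split => t /= H i; first by move=> _; rewrite /preimage /= in_itv /=.
    by have := H i I; rewrite /preimage /= in_itv.
  apply: fin_bigcap_measurable; first exact: finite_finset.
  move=> i _; rewrite -[X in measurable X]setTI; apply: measurable_tnth => //.
rewrite /= /pushforward muE.
rewrite (_ : _ @^-1` _ = `[a ord0, b ord0]%classic `*`
  [set t : n.-tuple (measurableTypeR R) |
    forall i, a (lift ord0 i) <= tnth t i <= b (lift ord0 i)]).
  have lE : lebesgue_measure (`[a ord0, b ord0]%classic : set R) =
      (b ord0 - a ord0)%:E.
    rewrite lebesgue_measure_itv /= lte_fin; case: ltP => // h.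
    by have -> : b ord0 - a ord0 = 0 by have := ab ord0; lra.
  apply: etrans (product_measure1E _ _ _ _) _ => //.
  by rewrite -muE vB big_ord_recl EFinM -lE.
apply/seteqP; split => -[x t]; rewrite /preimage /= in_itv /=.
  move=> H; split; first by have := H ord0; rewrite tnth0.
  by move=> i; have := H (lift ord0 i); rewrite tnthS.
move=> [H0 H1] i; case: (unliftP ord0 i) => [j|] -> /=; rewrite ?tnth0 ?tnthS //.
Qed.

(** * Volume of sets of row vectors *)

(* [volume A] is only meaningful under this condition. *)
Definition row_measurable (R : realType) d (A : set 'rV[R]_d) :=
  measurable [set t : d.-tuple (measurableTypeR R) | A (\row_i tnth t i)].

Section row_measurable.
Variables (R : realType) (d : nat).
Implicit Types A B C : set 'rV[R]_d.

Lemma row_measurableC A : row_measurable A -> row_measurable (~` A).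
Proof. exact: measurableC. Qed.

Lemma row_measurableI A B :
  row_measurable A -> row_measurable B -> row_measurable (A `&` B).
Proof. exact: measurableI. Qed.

Lemma row_measurableD A B :
  row_measurable A -> row_measurable B -> row_measurable (A `\` B).
Proof. exact: measurableD. Qed.

Lemma volume_ge0 A : (0 <= volume A)%E.
Proof.
have [mu muE] := lebesgue_tuple_sigma_finite R d.
by rewrite /volume muE measure_ge0.
Qed.

Lemma volume0 : volume (@set0 'rV[R]_d) = 0%E.
Proof.
have [mu muE] := lebesgue_tuple_sigma_finite R d.
by rewrite /volume muE measure0.
Qed.

Lemma volume_le A B : row_measurable A -> row_measurable B -> A `<=` B ->
  (volume A <= volume B)%E.
Proof.
move=> mA mB AB; have [mu muE] := lebesgue_tuple_sigma_finite R d.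
by rewrite /volume muE le_measure ?inE// => t; exact: AB.
Qed.

Lemma volume_split A B : row_measurable A -> row_measurable B ->
  volume A = (volume (A `&` B) + volume (A `\` B))%E.
Proof.
move=> mA mB; have [mu muE] := lebesgue_tuple_sigma_finite R d.
rewrite /volume muE -measureU; last 3 first.
- exact: measurableI.
- exact: measurableD.
- by apply/seteqP; split => // t [[_ Bt] [_ /(_ Bt)]].
congr (mu _); apply/seteqP; split => [t At|t [[]|[]] //].
by have [Bt|Bt] := pselect (B (\row_i tnth t i)); [left|right].
Qed.

(** The inclusion is pulled back along the homothety, so that the image of [A] never has to be
    measured. *)
Lemma volume_homothety A B (p : 'rV[R]_d) (r : R) :
  0 < r -> row_measurable A -> row_measurable B ->
  (forall v, A v -> B (p + r *: (v - p))) ->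
  ((r ^+ d)%:E * volume A <= volume B)%E.
Proof.
move=> r0 mA mB AB; have [mu muE] := lebesgue_tuple_sigma_finite R d.
(* In coordinates, [p + r *: (v - p)] reads [a i + r * v ord0 i]. *)
pose a i := (1 - r) * p ord0 i.
rewrite /volume [leRHS](lebesgue_tuple_affine a r0 mB).
rewrite lee_pmul2l ?lte_fin ?exprn_gt0// muE le_measure ?inE//.
  rewrite -[X in measurable X]setTI; exact: measurable_affine_tuple.
move=> t /= /AB; rewrite /preimage /=; congr B; apply/rowP => i.
by rewrite !mxE tnth_mktuple /a; ring.
Qed.

Lemma row_measurable_box (a b : 'I_d -> R) :
  (forall i, a i <= b i) ->
  row_measurable [set v : 'rV[R]_d | forall i, a i <= v ord0 i <= b i] /\
  volume [set v : 'rV[R]_d | forall i, a i <= v ord0 i <= b i] =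
  (\prod_i (b i - a i))%:E.
Proof.
move=> /lebesgue_tuple_box; rewrite /row_measurable /volume.
have -> // : [set t : d.-tuple (measurableTypeR R) | forall i, a i <= tnth t i <= b i] =
  [set t : d.-tuple (measurableTypeR R) |
    forall i, a i <= (\row_j tnth t j : 'rV[R]_d) ord0 i <= b i].
by apply/seteqP; split => t /= H i; have := H i; rewrite mxE.
Qed.

(** Measurability refers to the product structure on tuples, so an open set is written as a
    countable union of cubes with rational centres contained in it. *)
Lemma open_row_measurable A : open A -> row_measurable A.
Proof.
move=> oA.
pose box (q : 'rV[rat]_d) (k : nat) := [set v : 'rV[R]_d | forall i,
  ratr (q ord0 i) - k.+1%:R^-1 <= v ord0 i <= ratr (q ord0 i) + k.+1%:R^-1].
rewrite /row_measurable.
pose F (qk : 'rV[rat]_d * nat) := [set t : d.-tuple (measurableTypeR R) |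
  box qk.1 qk.2 (\row_i tnth t i) /\ box qk.1 qk.2 `<=` A].
rewrite (_ : [set t | _] = \bigcup_qk F qk).
  apply: countable_bigcupT_measurable => // -[q k].
  have [boxA|boxA] := pselect (box q k `<=` A).
    rewrite (_ : F _ = [set t | box q k (\row_i tnth t i)]); last first.
      by apply/seteqP; split => t // [].
    by apply: (row_measurable_box _).1 => i /=; rewrite lerD2l ge0_cp// invr_ge0.
  by rewrite (_ : F _ = set0)//; apply/seteqP; split => t // [].
apply/seteqP; split => [t /= At|t /= [[q k] _ [/= bt bA]]]; last exact: bA.
set v := \row_i _ in At.
have /nbhs_ballP [e e0 eA] : nbhs v A by exact: open_nbhs_nbhs.
(* Both [v] and any [w] in the cube are within [k.+1%:R^-1] of its centre in each coordinate, hence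
   within [e] of each other. *)
have [k ke] : exists k : nat, 0 + k.+1%:R^-1 < e / 2.
  by apply: ltr_add_invr; rewrite divr_gt0.
have qP i : exists q : rat, v ord0 i - k.+1%:R^-1 < ratr q < v ord0 i + k.+1%:R^-1.
  have : v ord0 i - k.+1%:R^-1 < v ord0 i + k.+1%:R^-1.
    by rewrite ltrD2l gt0_cp// invr_gt0.
  by move=> /rat_in_itvoo [q]; rewrite in_itv /=; exists q.
have [q qE] := choice qP.
exists (\row_i q i, k) => //; split => /=.
  move=> i; rewrite mxE; have /andP[] := qE i.
  by move: (k.+1%:R^-1 : R) => c; move=> *; apply/andP; split; lra.
move=> w bw; apply: eA; split => // i j; rewrite (ord1 i).
rewrite /ball /= ltr_norml.
have /andP[] := qE j; have /andP[] := bw j; rewrite /= mxE.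
by move: (k.+1%:R^-1 : R) ke => c; move=> *; apply/andP; split; lra.
Qed.

Lemma closed_row_measurable A : closed A -> row_measurable A.
Proof.
move=> cA; rewrite -(setCK A); apply: row_measurableC.
by apply: open_row_measurable; exact: closed_openC.
Qed.

End row_measurable.

(** * Euclidean geometry of knowledge sets *)

Section euclidean.
Variables (R : realType) (d : nat).
Implicit Types (u v w x : 'rV[R]_d) (S : set 'rV[R]_d).

Lemma dotE u v : dot u v = \sum_i u ord0 i * v ord0 i.
Proof. by rewrite /dot mxE; apply: eq_bigr => i _; rewrite mxE. Qed.

Lemma dotC u v : dot u v = dot v u.
Proof. by rewrite !dotE; apply: eq_bigr => i _; rewrite mulrC. Qed.

Lemma dotDl u v w : dot (u + v) w = dot u w + dot v w.
Proof. by rewrite /dot mulmxDl mxE. Qed.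

Lemma dotZl (a : R) u v : dot (a *: u) v = a * dot u v.
Proof. by rewrite /dot -scalemxAl mxE. Qed.

Lemma dotBl u v w : dot (u - v) w = dot u w - dot v w.
Proof. by rewrite -scaleN1r dotDl dotZl mulN1r. Qed.

Lemma dotDr u v w : dot u (v + w) = dot u v + dot u w.
Proof. by rewrite !(dotC u) dotDl. Qed.

Lemma dotZr (a : R) u v : dot u (a *: v) = a * dot u v.
Proof. by rewrite !(dotC u) dotZl. Qed.

Lemma dotBr u v w : dot u (v - w) = dot u v - dot u w.
Proof. by rewrite !(dotC u) dotBl. Qed.

Lemma dot_ge0 u : 0 <= dot u u.
Proof. by rewrite dotE; apply: sumr_ge0 => i _; rewrite -expr2 sqr_ge0. Qed.

Lemma unit_ballE v : unit_ball v <-> dot v v <= 1.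
Proof.
rewrite /unit_ball /= /norm2 -{1}(@sqrtr1 R) ler_sqrt//.
Qed.

(** Expanding [0 <= dot (u - v) (u - v)] stands in for Cauchy-Schwarz. *)
Lemma dot_unit_ball_le1 u v : unit_ball u -> unit_ball v -> dot u v <= 1.
Proof.
move=> /unit_ballE u1 /unit_ballE v1; have := dot_ge0 (u - v).
rewrite dotBl !dotBr (dotC v u); lra.
Qed.

Lemma unit_ballN v : unit_ball v -> unit_ball (- v).
Proof.
by move=> /unit_ballE v1; apply/unit_ballE; rewrite -scaleN1r dotZl dotZr; lra.
Qed.

Lemma normr_dot_unit_ball u v : unit_ball u -> unit_ball v -> `|dot u v| <= 1.
Proof.
move=> u1 v1; rewrite ler_norml dot_unit_ball_le1// andbT.
have := dot_unit_ball_le1 (unit_ballN u1) v1; rewrite -scaleN1r dotZl; lra.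
Qed.

Lemma unit_ball0 : unit_ball (0 : 'rV[R]_d).
Proof. by apply/unit_ballE; rewrite -(scale0r 0) dotZl mul0r. Qed.

Lemma unit_ball_coord v i : unit_ball v -> `|v ord0 i| <= 1.
Proof.
move=> /unit_ballE; rewrite dotE (bigD1 i)//=.
set s := \sum_(_ | _) _ => v1; have s0 : 0 <= s.
  by apply: sumr_ge0 => j _; rewrite -expr2 sqr_ge0.
by move: (v ord0 i) v1 => a v1; rewrite ler_norml; apply/andP; split; nra.
Qed.

(** The half-side [d%:R^-1] of the inscribed cube is cruder than the optimal inverse square root of
    [d]; this only affects the constant in front of [ln d%:R]. *)
Lemma unit_ball_small v :
  (forall i, `|v ord0 i| <= d%:R^-1) -> unit_ball v.
Proof.
move=> vd; apply/unit_ballE; rewrite dotE.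
have [d0|d0] := posnP d.
  by rewrite big1 ?ler01// => -[i id] _; exfalso; rewrite d0 in id.
apply: (@le_trans _ _ (\sum_(i < d) d%:R^-1)); last first.
  by rewrite sumr_const card_ord -[leLHS]mulr_natr mulVf// pnatr_eq0 -lt0n.
apply: ler_sum => i _; have := vd i.
have : d%:R^-1 <= 1 :> R by rewrite invf_le1 ?ltr0n// ler1n.
by rewrite ler_norml; move: (v ord0 i) => a d1 /andP[ad da]; nra.
Qed.

(** The segment is written as a homothety of centre [u], so that convexity applies directly to the
    images in [volume_homothety]. *)
Definition convex_row S := forall u v (r : R),
  S u -> S v -> 0 <= r <= 1 -> S (u + r *: (v - u)).

Lemma unit_ball_convex : convex_row (@unit_ball R d).
Proof.
move=> u v r u1 v1 /andP[r0 r1]; have uv := dot_unit_ball_le1 u1 v1.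
move: u1 v1 => /unit_ballE u1 /unit_ballE v1; apply/unit_ballE.
rewrite !(dotBl, dotBr, dotDl, dotDr, dotZl, dotZr) (dotC v u).
move: (dot u u) (dot u v) (dot v v) u1 uv v1 => a b c a1 b1 c1.
(* One minus the squared norm of the combination is the sum of the quantities in [h1] and [h2] and
   twice that in [h3]. *)
have h1 : 0 <= (1 - r) ^+ 2 * (1 - a) by rewrite mulr_ge0 ?sqr_ge0 ?subr_ge0.
have h2 : 0 <= r ^+ 2 * (1 - c) by rewrite mulr_ge0 ?sqr_ge0 ?subr_ge0.
have h3 : 0 <= r * (1 - r) * (1 - b) by rewrite !mulr_ge0 ?subr_ge0.
by lra.
Qed.

Lemma minkowski_ball_convex S z : convex_row S -> convex_row (minkowski_ball S z).
Proof.
move=> cS _ _ r [w Sw [u u1 <-]] [w' Sw' [u' u'1 <-]] r01.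
exists (w + r *: (w' - w)); first exact: cS.
exists (u + r *: (u' - u)); first exact: unit_ball_convex.
by apply/rowP => i; rewrite !mxE; ring.
Qed.

Lemma sub_minkowski_ball S z : S `<=` minkowski_ball S z.
Proof.
by move=> w Sw; exists w => //; exists 0; [exact: unit_ball0|rewrite scaler0 addr0].
Qed.

Lemma minkowski_ballS S S' z : S `<=` S' -> minkowski_ball S z `<=` minkowski_ball S' z.
Proof. by move=> SS' _ [w Sw [u u1 <-]]; exists w; [exact: SS'|exists u]. Qed.

Lemma continuous_dot (f g : 'rV[R]_d -> 'rV[R]_d) :
  continuous f -> continuous g -> continuous (fun v => dot (f v) (g v)).
Proof.
move=> cf cg.
rewrite (_ : (fun v => _) = fun v => \sum_i f v ord0 i * g v ord0 i); last first.
  by apply/funext => v; rewrite dotE.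
apply: continuous_big => [|i _]; first exact: add_continuous.
move=> v; apply: (@continuousM _ _ (fun v => f v ord0 i) (fun v => g v ord0 i)).
  by apply: (@continuous_comp _ _ _ f (fun M => M ord0 i)); [exact: cf|exact: coord_continuous].
by apply: (@continuous_comp _ _ _ g (fun M => M ord0 i)); [exact: cg|exact: coord_continuous].
Qed.

Lemma continuous_dotl x : continuous (fun v => dot v x).
Proof.
by apply: (@continuous_dot id (fun=> x)) => v; [exact: cvg_id|exact: cst_continuous].
Qed.

Lemma closed_unit_ball : closed (@unit_ball R d).
Proof.
rewrite (_ : @unit_ball R d = (fun v => dot v v) @^-1` [set r | r <= 1]).
  apply: preimage_closed; last exact: closed_le.
  by move=> v _; apply: (@continuous_dot id id) => w; exact: cvg_id.
by apply/seteqP; split => v /unit_ballE.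
Qed.

Lemma closed_sub_unit_ball_compact S : closed S -> S `<=` @unit_ball R d -> compact S.
Proof.
move=> cS SB.
have : compact [set v : 'rV[R]_d | forall i, `[-1, 1]%classic (v ord0 i)].
  by apply: (@rV_compact R d (fun=> `[-1, 1]%classic)) => _; exact: segment_compact.
move=> cB; apply: (subclosed_compact cS cB) => v /SB v1 i.
by rewrite /= in_itv /= -ler_norml unit_ball_coord.
Qed.

(** The enlarged set is the continuous image of a compact product. Closedness is what makes its
    volume meaningful. *)
Lemma minkowski_ball_closed S z : compact S -> closed (minkowski_ball S z).
Proof.
move=> cS; apply: compact_closed; first exact: norm_hausdorff.
have -> : minkowski_ball S z =
    (fun p : 'rV[R]_d * 'rV[R]_d => p.1 + z *: p.2) @` (S `*` @unit_ball R d).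
  apply/seteqP; split => [_ [w Sw [u u1 <-]]|_ [[w u] [Sw u1] <-]].
    by exists (w, u).
  by exists w => //; exists u.
apply: continuous_compact.
  apply: continuous_subspaceT => p; apply: cvgD; first exact: cvg_fst.
  by apply: cvgZr; exact: cvg_snd.
apply: compact_setX => //; apply: closed_sub_unit_ball_compact => //.
exact: closed_unit_ball.
Qed.

Lemma closed_halfspace_ge x (y : R) : closed [set v | y <= dot v x].
Proof.
by apply: (@preimage_closed _ _ (fun v => dot v x) [set r | y <= r]);
  [move=> v _; exact: continuous_dotl|exact: closed_ge].
Qed.

End euclidean.

(** * Convexity and compactness of knowledge sets *)

Section knowledge_set.
Variables (R : realType) (d : nat) (x : nat -> 'rV[R]_d) (y sigma : nat -> R).

Lemma knowledge_set_unit_ball t : knowledge_set x y sigma t `<=` @unit_ball R d.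
Proof. by move=> v []. Qed.

Lemma knowledge_set_anti s t : (s <= t)%N ->
  knowledge_set x y sigma t `<=` knowledge_set x y sigma s.
Proof. by move=> st v [v1 H]; split => // i /leq_trans /(_ st); exact: H. Qed.

Lemma knowledge_set_convex t : convex_row (knowledge_set x y sigma t).
Proof.
move=> u v r [u1 Hu] [v1 Hv] r01; split; first exact: unit_ball_convex.
move=> i it; have := Hu i it; have := Hv i it; move/andP: r01 => [r0 r1].
rewrite dotDl dotZl dotBl => a b.
(* Each constraint is affine in the point, so its value on a segment is a convex combination of the
   end values. *)
rewrite [leRHS](_ : _ = (1 - r) * (sigma i * (y i - dot u (x i))) +
  r * (sigma i * (y i - dot v (x i)))); last by ring.
by rewrite addr_ge0// mulr_ge0//; lra.
Qed.

Lemma knowledge_set_compact t : compact (knowledge_set x y sigma t).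
Proof.
apply: closed_sub_unit_ball_compact; last exact: knowledge_set_unit_ball.
rewrite (_ : knowledge_set x y sigma t = @unit_ball R d `&`
  \bigcap_(i in [set i | (i < t)%N])
    (fun v => dot v (x i)) @^-1` [set r | 0 <= sigma i * (y i - r)]).
  apply: closedI; first exact: closed_unit_ball.
  apply: closed_bigI => i _; apply: preimage_closed.
    by move=> v _; exact: continuous_dotl.
  apply: (@preimage_closed _ _ (fun r => sigma i * (y i - r)) [set r | 0 <= r]).
    move=> r _; apply: cvgMr; apply: cvgB; [exact: cvg_cst|exact: cvg_id].
  exact: closed_ge.
by apply/seteqP; split => v [].
Qed.

End knowledge_set.

(** * Shifting a halving cut *)

(** Used with [n = d] and [a] of order [1 / d], it keeps the volume factor of a homothety above a
    constant free of [d]. *)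
Lemma bernoulli_one_minus (R : realDomainType) (a : R) n :
  0 <= a <= 1 -> 1 - n%:R * a <= (1 - a) ^+ n.
Proof.
move=> /andP[a0 a1]; elim: n => [|n IH]; first by rewrite mul0r subr0 expr0.
rewrite exprS -natr1.
have n0 : 0 <= n%:R :> R by [].
have h : (1 - a) * (1 - n%:R * a) <= (1 - a) * (1 - a) ^+ n.
  by rewrite ler_wpM2l// subr_ge0.
apply: le_trans h; rewrite -subr_ge0.
by rewrite [leRHS](_ : _ = n%:R * (a * a)) ?mulr_ge0//; ring.
Qed.

Section cut.
Variables (R : realType) (d : nat) (K : set 'rV[R]_d) (x : 'rV[R]_d) (y z V : R).
Hypotheses (d_gt0 : (0 < d)%N) (z_gt0 : 0 < z) (cK : convex_row K) (mK : row_measurable K).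
Hypothesis volK : volume K = V%:E.

Let dR : 0 < d%:R :> R. Proof. by rewrite ltr0n. Qed.

Lemma volume_finite A : row_measurable A -> A `<=` K ->
  exists2 s, 0 <= s & volume A = s%:E.
Proof.
move=> mA AK; exists (fine (volume A)); first by rewrite fine_ge0// volume_ge0.
rewrite fineK// ge0_fin_numE ?volume_ge0//.
by rewrite (le_lt_trans (volume_le mA mK AK))// volK ltry.
Qed.

(** The upper side of the cut, lowered by [z]: it holds the enlarged set that remains when the
    feedback keeps the upper side. *)
Let slab := K `&` [set v | y - z <= dot v x].

(* Shrink [Q] towards [w1] if [w1] lies far below the cut: the image misses the
   slab. Otherwise [w2] lies far above it, and the slab shrunk towards [w2]
   falls into [P]. *)
Lemma volume_shifted_cut (P Q : set 'rV[R]_d) (w1 w2 : 'rV[R]_d) :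
  row_measurable P -> row_measurable Q -> row_measurable slab ->
  K `&` [set v | y < dot v x] `<=` P ->
  Q `<=` K `&` [set v | dot v x <= y] ->
  volume P = (V / 2)%:E -> volume Q = (V / 2)%:E ->
  K w1 -> K w2 -> 4 * d%:R * z < dot w2 x - dot w1 x ->
  (volume slab <= (5 / 6 * V)%:E)%E.
Proof.
move=> mP mQ mS KP QK volP volQ Kw1 Kw2 w12.
have V0 : 0 <= V by rewrite -lee_fin -volK volume_ge0.
have mL : row_measurable (K `\` slab) by exact: row_measurableD.
have [s s0 sE] : exists2 s, 0 <= s & volume slab = s%:E.
  by apply: volume_finite => // v [].
have [l l0 lE] : exists2 l, 0 <= l & volume (K `\` slab) = l%:E.
  by apply: volume_finite => // v [].
have := volume_split mK mS; rewrite volK.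
have -> : K `&` slab = slab by apply/setIidPr => v [].
rewrite sE lE -EFinD => -[VE]; rewrite lee_fin.
have d1 : 1 <= d%:R :> R by rewrite ler1n.
(* The gap [4 * d%:R * z] splits into 3/2 and 5/2 times [d%:R * z]. This split makes both cases end
   with the same factor 5/6. *)
have [far1|near1] := ltP (3 / 2 * d%:R * z) (y - dot w1 x).
  (* Chosen so that [a * (3 / 2 * d%:R * z) = z]: the image of [Q] falls strictly below height
     [y - z]. Its volume is at least [(1 - 2 / 3) * (V / 2) = V / 6], all of it lost to [slab]. *)
  pose a : R := 2 / 3 / d%:R.
  have ad : d%:R * a = 2 / 3 by rewrite /a mulrC divfK// gt_eqF.
  have a0 : 0 < a by rewrite divr_gt0.
  have a1 : a < 1 by rewrite ltr_pdivrMr// mul1r; lra.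
  have := @volume_homothety R d Q (K `\` slab) w1 (1 - a).
  rewrite volQ lE -EFinM lee_fin subr_gt0 => /(_ a1 mQ mL) vl.
  have {vl} : (1 - a) ^+ d * (V / 2) <= l.
    apply: vl => v /QK [Kv hv]; split; first by apply: cK => //; lra.
    move=> [_] /=; apply/negP; rewrite -ltNge dotDl dotZl dotBl.
    have : a * (3 / 2 * d%:R * z) < a * (y - dot w1 x) by rewrite ltr_pM2l.
    have : (1 - a) * dot v x <= (1 - a) * y by rewrite ler_wpM2l// subr_ge0 ltW.
    have -> : a * (3 / 2 * d%:R * z) = 3 / 2 * (d%:R * a) * z by ring.
    by rewrite ad; lra.
  have : 1 - d%:R * a <= (1 - a) ^+ d by apply: bernoulli_one_minus; lra.
  by rewrite ad; move: ((1 - a) ^+ d) => c; nra.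
(* Chosen so that [a * (5 / 2 * d%:R * z) = z]: the image of [slab] rises strictly above height [y].
   Then [(1 - 2 / 5) * s <= V / 2], that is, [s <= 5 / 6 * V]. *)
pose a : R := 2 / 5 / d%:R.
have ad : d%:R * a = 2 / 5 by rewrite /a mulrC divfK// gt_eqF.
have a0 : 0 < a by rewrite divr_gt0.
have a1 : a < 1 by rewrite ltr_pdivrMr// mul1r; lra.
have := @volume_homothety R d slab P w2 (1 - a).
rewrite volP sE -EFinM lee_fin subr_gt0 => /(_ a1 mS mP) vs.
have {vs} : (1 - a) ^+ d * s <= V / 2.
  apply: vs => v [Kv /= hv]; apply: KP; split; first by apply: cK => //; lra.
  rewrite /= dotDl dotZl dotBl.
  have : a * (5 / 2 * d%:R * z) < a * (dot w2 x - y) by rewrite ltr_pM2l//; lra.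
  have : (1 - a) * (y - z) <= (1 - a) * dot v x by rewrite ler_wpM2l// subr_ge0 ltW.
  have : 0 < a * z by rewrite mulr_gt0.
  have -> : a * (5 / 2 * d%:R * z) = 5 / 2 * (d%:R * a) * z by ring.
    by rewrite ad; lra.
have : 1 - d%:R * a <= (1 - a) ^+ d by apply: bernoulli_one_minus; lra.
by rewrite ad; move: ((1 - a) ^+ d) => c; nra.
Qed.

End cut.

(** * Scales and enlarged knowledge sets *)

Section scale.
Variables (R : realType) (d : nat) (S : set 'rV[R]_d) (x v0 : 'rV[R]_d).
Hypotheses (d_gt0 : (0 < d)%N) (SB : S `<=` @unit_ball R d) (Sv0 : S v0).
Hypothesis x1 : unit_ball x.

Let dR : 0 < d%:R :> R. Proof. by rewrite ltr0n. Qed.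

Lemma has_sup_dot : has_sup [set dot v x | v in S].
Proof.
split; first by exists (dot v0 x); exists v0.
by exists 1 => _ [v Sv <-]; exact: dot_unit_ball_le1 (SB Sv) x1.
Qed.

Lemma has_inf_dot : has_inf [set dot v x | v in S].
Proof.
split; first by exists (dot v0 x); exists v0.
exists (-1) => _ [v Sv <-].
by have := normr_dot_unit_ball (SB Sv) x1; rewrite ler_norml => /andP[].
Qed.

Lemma dot_sub_le_width v w : S v -> S w -> dot v x - dot w x <= width S x.
Proof.
move=> Sv Sw; rewrite /width lerB//.
  by apply: ub_le_sup; [exact: has_sup_dot.2|exists v].
by apply: ge_inf; [exact: has_inf_dot.2|exists w].
Qed.

Lemma width_le2 : width S x <= 2.
Proof.
have := sup_le_ub (x := 1) has_sup_dot.1.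
have := lb_le_inf (x := -1) has_inf_dot.1.
rewrite /width => h1 h2.
suff : inf [set dot v x | v in S] >= -1 /\ sup [set dot v x | v in S] <= 1 by case; lra.
split; [apply: h1|apply: h2] => _ [v Sv <-].
  by have := normr_dot_unit_ball (SB Sv) x1; rewrite ler_norml => /andP[].
exact: dot_unit_ball_le1 (SB Sv) x1.
Qed.

Lemma width_adherent c : c < width S x ->
  exists w1 w2, [/\ S w1, S w2 & c < dot w2 x - dot w1 x].
Proof.
move=> cw; pose e := (width S x - c) / 2.
have e0 : 0 < e by rewrite divr_gt0// subr_gt0.
have [_ [w2 Sw2 <-] h2] := sup_adherent e0 has_sup_dot.
have [_ [w1 Sw1 <-] h1] := inf_adherent e0 has_inf_dot.
exists w1, w2; split => //.
by move: h1 h2; rewrite /e /width; lra.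
Qed.

(** Maximality is used twice: against -1, as the width is at most 2, to make [i + 1] a natural
    number [k]; and against [i + 1] itself, to bound the width from below. *)
Lemma largest_scaleP (i : int) : largest_scale S x i ->
  exists2 k : nat, i = k%:Z - 1 & 1 / 2 ^+ k < width S x <= 2 / 2 ^+ k.
Proof.
move=> [wi imax].
have : -1 <= i by apply: imax; rewrite opprK; exact: width_le2.
rewrite -(lerD2r 1) addNr => i0.
have ik : i = (absz (i + 1))%:Z - 1 by rewrite gez0_abs// addrK.
exists (absz (i + 1)) => //; set k := (absz (i + 1)) in ik *.
have pk n : (2 : R) ^ (- n%:Z) = 1 / 2 ^+ n by rewrite -invr_expz div1r.
apply/andP; split; last first.
  by move: wi; rewrite ik opprB addrC expfzDr// pk expr1z; lra.
rewrite -pk ltNge; apply/negP => /imax.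
by rewrite ik lerDl.
Qed.

Lemma scale_radiusE (k : nat) :
  scale_radius R d (k%:Z - 1) = (2 / 2 ^+ k) / (8 * d%:R).
Proof.
by rewrite /scale_radius opprB addrC expfzDr// -invr_expz expr1z (mulrC (2 ^ k)^-1).
Qed.

(** This explains the 8 in the radius: [4 * d%:R * z], the gap demanded by [volume_shifted_cut],
    becomes exactly the lower end of the widths of level [k]. *)
Lemma scale_radius_level (k : nat) :
  4 * d%:R * scale_radius R d (k%:Z - 1) = 1 / 2 ^+ k.
Proof.
by rewrite scale_radiusE; field; rewrite expf_eq0 /= pnatr_eq0 andbF /= gt_eqF.
Qed.

End scale.

Section minkowski_volume.
Variables (R : realType) (d : nat) (S : set 'rV[R]_d) (z : R).
Hypotheses (d_gt0 : (0 < d)%N) (z_ge0 : 0 <= z).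

Let dR : 0 < d%:R :> R. Proof. by rewrite ltr0n. Qed.

(** The cube of half-side [z / d%:R] around [v0] fits into the ball of radius [z] around [v0]. *)
Lemma volume_minkowski_ball_ge v0 : S v0 -> row_measurable (minkowski_ball S z) ->
  (((2 * z / d%:R) ^+ d)%:E <= volume (minkowski_ball S z))%E.
Proof.
move=> Sv0 mK.
have ab i : v0 ord0 i - z / d%:R <= v0 ord0 i + z / d%:R.
  by rewrite lerD2l ge0_cp// divr_ge0// ltW.
have [mb vb] := row_measurable_box ab.
have -> : (2 * z / d%:R) ^+ d = \prod_(i < d) (v0 ord0 i + z / d%:R - (v0 ord0 i - z / d%:R)).
  rewrite -[in LHS](card_ord d) -prodr_const; apply: eq_bigr => i _; rewrite card_ord; ring.
rewrite -vb; apply: volume_le => // v bv.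
(* At [z = 0] the cube is the single point [v0], and rescaling by [z^-1] would be meaningless. *)
exists v0 => //; have [z0|z0] := eqVneq z 0.
  exists 0; first exact: unit_ball0.
  apply/rowP => i; rewrite scaler0 addr0; have /andP[] := bv i.
  by rewrite z0 mul0r; lra.
exists (z^-1 *: (v - v0)); last by rewrite scalerA divff// scale1r addrC subrK.
apply: unit_ball_small => i; rewrite !mxE normrM normfV (ger0_norm z_ge0).
rewrite mulrC ler_pdivrMr ?lt_def ?z0// mulrC ler_norml.
by have /andP[] := bv i; move: (z / d%:R) => c; move=> *; apply/andP; split; lra.
Qed.

Lemma volume_minkowski_ball_le : S `<=` @unit_ball R d ->
  row_measurable (minkowski_ball S z) ->
  (volume (minkowski_ball S z) <= ((2 * (1 + z)) ^+ d)%:E)%E.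
Proof.
move=> SB mK.
have ab (i : 'I_d) : - (1 + z) <= 1 + z by have := z_ge0; lra.
have [mb vb] := row_measurable_box ab.
have -> : (2 * (1 + z)) ^+ d = \prod_(i < d) (1 + z - - (1 + z)).
  rewrite -[in LHS](card_ord d) -prodr_const; apply: eq_bigr => i _; ring.
rewrite -vb; apply: volume_le => // _ [w Sw [u u1 <-]] i.
rewrite !mxE -ler_norml (le_trans (ler_normD _ _))// normrM (ger0_norm z_ge0).
rewrite lerD// ?unit_ball_coord//; first exact: SB.
by rewrite ler_piMr// unit_ball_coord.
Qed.

End minkowski_volume.

(** * A single round: volume drop and loss *)

Section round.
Variables (R : realType) (d : nat) (S : set 'rV[R]_d) (x v0 : 'rV[R]_d) (y : R).
Variables (z : R) (k : nat).
Hypotheses (d_gt0 : (0 < d)%N) (compS : compact S) (convS : convex_row S).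
Hypotheses (SB : S `<=` @unit_ball R d) (Sv0 : S v0) (x1 : unit_ball x).
Hypothesis z_radius : 4 * d%:R * z = 1 / 2 ^+ k.
Hypothesis width_k : 1 / 2 ^+ k < width S x <= 2 / 2 ^+ k.

Let K := minkowski_ball S z.

Hypothesis half :
  volume [set v | K v /\ y <= dot v x] = ((2^-1)%:E * volume K)%E.

Let dR : 0 < d%:R :> R. Proof. by rewrite ltr0n. Qed.

Let z_gt0 : 0 < z.
Proof.
have : 0 < 4 * d%:R * z by rewrite z_radius divr_gt0// exprn_gt0.
by rewrite pmulr_rgt0// mulr_gt0.
Qed.

Let mK : row_measurable K.
Proof. by apply: closed_row_measurable; exact: minkowski_ball_closed. Qed.

(** A positive finite volume makes the halving equation informative: neither side of the cut can be
    empty. *)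
Let volK : exists2 V, 0 < V & volume K = V%:E.
Proof.
have := volume_minkowski_ball_ge (ltW z_gt0) Sv0 mK.
have := volume_minkowski_ball_le (ltW z_gt0) SB mK; rewrite -/K.
case: (volume K) => [V||] //; rewrite !lee_fin => _ VK.
exists V => //; apply: lt_le_trans VK.
by rewrite exprn_gt0// divr_gt0// mulr_gt0.
Qed.

Let dot_minkowski u w : unit_ball u -> `|dot (w + z *: u) x - dot w x| <= z.
Proof.
move=> u1; rewrite dotDl addrC addKr dotZl normrM (gtr0_norm z_gt0).
by rewrite ler_piMr ?(ltW z_gt0)// normr_dot_unit_ball.
Qed.

(** The set [S'] lies on one side of the cut and enlarging it changes [dot _ x] by at most [z], so
    the enlarged set stays within the cut shifted by [z]. *)
Lemma volume_feedback (s : R) (S' : set 'rV[R]_d) :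
  s = 1 \/ s = -1 -> compact S' -> S' `<=` S ->
  (forall v, S' v -> 0 <= s * (y - dot v x)) ->
  (volume (minkowski_ball S' z) <= (5 / 6)%:E * volume K)%E.
Proof.
move=> s1 compS' S'S S'y; have [V V0 VE] := volK.
have mK' : row_measurable (minkowski_ball S' z).
  by apply: closed_row_measurable; exact: minkowski_ball_closed.
have /andP[wide _] := width_k.
have [w1 [w2 [Sw1 Sw2]]] := width_adherent SB Sv0 x1 wide.
rewrite -z_radius => w12.
have cK : convex_row K by exact: minkowski_ball_convex.
have SK : S `<=` K := @sub_minkowski_ball _ _ S z.
pose P := K `&` [set v | y <= dot v x]; pose Q := K `\` [set v | y <= dot v x].
have mH (a : 'rV[R]_d) (b : R) : row_measurable [set v | b <= dot v a].
  by apply: closed_row_measurable; exact: closed_halfspace_ge.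
have mP : row_measurable P by exact: row_measurableI.
have mQ : row_measurable Q by exact: row_measurableD.
have volP : volume P = (V / 2)%:E by rewrite half VE -EFinM mulrC.
have volQ : volume Q = (V / 2)%:E.
  have := volume_split mK (mH x y); rewrite -/P -/Q volP VE.
  case: (volume Q) => [q||] //; rewrite -EFinD => -[Vq].
  by congr (_%:E); lra.
rewrite VE -EFinM.
case: s1 => s1; last first.
  apply: le_trans (volume_shifted_cut (x := x) (y := y) d_gt0 z_gt0 cK mK VE mP mQ
    _ _ _ volP volQ (SK _ Sw1) (SK _ Sw2) w12).
  - apply: volume_le => //; first exact: row_measurableI.
    move=> _ [w S'w [u u1 <-]]; split; first by exists w; [exact: S'S|exists u].
    have := dot_minkowski w u1; rewrite ler_norml => /andP[h _].
    by have := S'y _ S'w; rewrite s1 /=; lra.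
  - exact: row_measurableI.
  - by move=> v [Kv /= /ltW yv].
  - by move=> v [Kv /= /negP]; rewrite -ltNge => /ltW.
(* Feedback 1 keeps the lower side. Reflecting [x] and [y] reduces it to the upper case, with [P],
   [Q] and [w1], [w2] exchanged. *)
have dotNr v : dot v (- x) = - dot v x by rewrite -scaleN1r dotZr mulN1r.
have w12' : 4 * d%:R * z < dot w1 (- x) - dot w2 (- x) by rewrite !dotNr; lra.
apply: le_trans (volume_shifted_cut (x := - x) (y := - y) d_gt0 z_gt0 cK mK VE mQ mP
    _ _ _ volQ volP (SK _ Sw2) (SK _ Sw1) w12').
- apply: (volume_le _ (row_measurableI mK (mH (- x) (- y - z)))) => //.
  move=> _ [w S'w [u u1 <-]]; split; first by exists w; [exact: S'S|exists u].
  have := dot_minkowski w u1; rewrite ler_norml => /andP[_ h].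
  by have := S'y _ S'w; rewrite s1 /= dotNr; lra.
- exact: row_measurableI.
- move=> v [Kv /=]; rewrite dotNr ltrN2 => h; split => //=.
  by apply/negP; rewrite -ltNge.
- by move=> v [Kv /= h]; split => //=; rewrite dotNr lerN2.
Qed.

(** The guess is within [z] of the range of [dot _ x] on [S], since otherwise one side of the cut
    would be empty. The loss is thus at most the width plus [z], in fact at most [3 / 2 ^+ k]. *)
Lemma round_loss : `|y - dot v0 x| <= 4 / 2 ^+ k.
Proof.
have [V V0 VE] := volK; move: half; rewrite VE -EFinM => halfV.
have zk : z <= 1 / 2 ^+ k.
  rewrite -z_radius ler_peMl ?(ltW z_gt0)//.
  by have : 1 <= d%:R :> R; [rewrite ler1n|lra].
have sub w u : S w -> S u -> dot w x - dot u x <= 2 / 2 ^+ k.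
  by move=> Sw Su; apply: le_trans (dot_sub_le_width SB Sv0 x1 Sw Su) _; case/andP: width_k.
have [w [Sw yw]] : exists w, S w /\ y <= dot w x + z.
  apply: contrapT => /forallNP no; move: halfV; rewrite (_ : [set v | _] = set0).
    by rewrite volume0 => -[]; lra.
  apply/seteqP; split => // _ [[w Sw [u u1 <-]] yw]; apply: (no w); split => //.
  by have := dot_minkowski w u1; rewrite ler_norml => /andP[_ h]; lra.
have [w' [Sw' yw']] : exists w, S w /\ dot w x - z < y.
  apply: contrapT => /forallNP no; move: halfV; rewrite (_ : [set v | _] = K).
    by rewrite VE => -[]; lra.
  apply/seteqP; split => [v []//|_ [w' Sw' [u u1 <-]]]; split.
    by exists w' => //; exists u.
  rewrite leNgt; apply/negP => yw'; apply: (no w'); split => //.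
  by have := dot_minkowski w' u1; rewrite ler_norml => /andP[h _]; lra.
have := sub _ _ Sw Sv0; have := sub _ _ Sv0 Sw'.
by rewrite ler_norml => *; apply/andP; split; lra.
Qed.

End round.

(** * Counting the rounds of each scale *)

Lemma sum_linear_geometric_le (R : realFieldType) (a b : R) n : 0 <= a -> 0 <= b ->
  \sum_(k < n) (a * k.+3%:R + b) / 2 ^+ k <= 8 * a + 2 * b.
Proof.
move=> a0 b0.
(* Induction runs on the exact partial sum, whose subtracted tail is nonnegative. *)
have -> : \sum_(k < n) (a * k.+3%:R + b) / 2 ^+ k =
    8 * a + 2 * b - (a * (2 * n%:R + 8) + 2 * b) / 2 ^+ n.
  elim: n => [|n IH]; first by rewrite big_ord0 expr0; field.
  rewrite big_ord_recr /= IH exprS -!natr1; field.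
  by rewrite expf_neq0// gt_eqF//; lra.
by rewrite gerBl divr_ge0 ?exprn_ge0// addr_ge0 ?mulr_ge0//.
Qed.

Section search.
Variables (R : realType) (d T : nat) (v0 : 'rV[R]_d).
Variables (x : nat -> 'rV[R]_d) (y sigma : nat -> R).
Hypotheses (d_gt0 : (0 < d)%N) (v01 : unit_ball v0).
Hypothesis x1 : forall t, (t < T)%N -> unit_ball (x t).
Hypothesis feedback : forall t, (t < T)%N ->
  valid_feedback (dot v0 (x t)) (y t) (sigma t).
Hypothesis guess : forall t, (t < T)%N ->
  msp_guess (knowledge_set x y sigma t) (x t) (y t).

Let S t := knowledge_set x y sigma t.

Let dR : 0 < d%:R :> R. Proof. by rewrite ltr0n. Qed.

Let z (k : nat) := scale_radius R d (k%:Z - 1).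

(* Level [k] stands for the scale index [i = k - 1]; since the width is at most
   2, no smaller index occurs. *)
Definition round_level t (k : nat) :=
  1 / 2 ^+ k < width (S t) (x t) <= 2 / 2 ^+ k /\
  volume [set v | minkowski_ball (S t) (z k) v /\ y t <= dot v (x t)] =
  ((2^-1)%:E * volume (minkowski_ball (S t) (z k)))%E.

Lemma knowledge_set_hidden t : (t <= T)%N -> S t v0.
Proof.
move=> tT; split=> // i it; have [[->|->] h1 h2] := feedback (leq_trans it tT).
  by rewrite mul1r subr_ge0 leNgt; apply/negP => /h2; lra.
by rewrite mulN1r oppr_ge0 subr_le0 leNgt; apply/negP => /h1; lra.
Qed.

Lemma round_level_exists t : (t < T)%N -> width (S t) (x t) != 0 ->
  exists k, round_level t k.
Proof.
move=> tT w0; have [_ /(_ w0)[i iP half]] := guess tT.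
have [k ik wk] := largest_scaleP (@knowledge_set_unit_ball _ _ _ _ _ t)
  (knowledge_set_hidden (ltnW tT)) (x1 tT) iP.
by exists k; split => //; rewrite /z -ik.
Qed.

Lemma round_level_loss t k : (t < T)%N -> round_level t k ->
  `|y t - dot v0 (x t)| <= 4 / 2 ^+ k.
Proof.
move=> tT [wk half].
apply: (@round_loss R d (S t) (x t) v0 (y t) (z k)) => //.
- exact: knowledge_set_compact.
- exact: knowledge_set_unit_ball.
- exact: knowledge_set_hidden (ltnW tT).
- exact: x1.
- exact: scale_radius_level.
Qed.

Lemma zero_width_loss t : (t < T)%N -> width (S t) (x t) = 0 ->
  y t = dot v0 (x t).
Proof.
move=> tT w0; have [/(_ w0)[v Sv ->] _] := guess tT.
have Sv0 := knowledge_set_hidden (ltnW tT).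
have SB := @knowledge_set_unit_ball _ _ x y sigma t.
have := dot_sub_le_width SB Sv0 (x1 tT) Sv Sv0.
have := dot_sub_le_width SB Sv0 (x1 tT) Sv0 Sv.
rewrite -/(S t) w0; lra.
Qed.

(** Restricted to the first [n] rounds because the potential argument is an induction on time. *)
Definition level_count k n : nat := \sum_(t < n) `[< round_level t k >].

(** The potential argument at a fixed level: it starts from the enclosing cube, a counted round
    brings the factor 5/6, and any other round only uses that knowledge sets shrink. *)
Lemma volume_level_count k n : (n <= T)%N ->
  (volume (minkowski_ball (S n) (z k)) <=
   ((5 / 6) ^+ level_count k n * (2 * (1 + z k)) ^+ d)%:E)%E.
Proof.
have z0 : 0 < z k by rewrite /z scale_radiusE !divr_gt0 ?mulr_gt0 ?exprn_gt0.
have mK m : row_measurable (minkowski_ball (S m) (z k)).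
  by apply: closed_row_measurable; apply: minkowski_ball_closed; exact: knowledge_set_compact.
elim: n => [_|n IH nT].
  rewrite /level_count big_ord0 expr0 mul1r; apply: volume_minkowski_ball_le => //.
    exact: ltW.
  exact: knowledge_set_unit_ball.
have anti : S n.+1 `<=` S n by apply: knowledge_set_anti.
rewrite /level_count big_ord_recr /=; case: asboolP => [[wk half]|_]; last first.
  rewrite addn0; apply: le_trans (IH (ltnW nT)); apply: volume_le => //.
  exact: minkowski_ballS.
rewrite addn1 exprS -mulrA EFinM.
have h : (volume (minkowski_ball (S n.+1) (z k)) <=
    (5 / 6)%:E * volume (minkowski_ball (S n) (z k)))%E.
  have [s1 _ _] := feedback nT.
  apply: (volume_feedback d_gt0 (@knowledge_set_compact _ _ x y sigma n)
    (@knowledge_set_convex _ _ x y sigma n) (@knowledge_set_unit_ball _ _ x y sigma n)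
    (knowledge_set_hidden (ltnW nT)) (x1 nT) (scale_radius_level R d_gt0 k) wk half s1) => //.
    exact: knowledge_set_compact.
  by move=> v [_]; apply.
apply: (le_trans h); rewrite lee_pmul2l ?lte_fin ?divr_gt0//.
exact: IH (ltnW nT).
Qed.

(** The hidden vector survives all rounds, so the potential never drops below the volume of a small
    cube around it. Comparing with the decay and taking logarithms bounds the count. *)
Lemma level_count_le k :
  (level_count k T)%:R * ln (6 / 5) <= d%:R * (ln 2 * k.+3%:R + 2 * ln d%:R) :> R.
Proof.
have zE : z k = 2 / 2 ^+ k / (8 * d%:R) by exact: scale_radiusE.
have k0 : 0 < 2 ^+ k :> R by rewrite exprn_gt0.
have z0 : 0 < z k by rewrite zE !divr_gt0 ?mulr_gt0.
have d1 : 1 <= d%:R :> R by rewrite ler1n.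
have k1 : 1 <= 2 ^+ k :> R by rewrite exprn_ege1// ler1n.
have lower_upper : (2 * z k / d%:R) ^+ d <=
    (5 / 6) ^+ level_count k T * (2 * (1 + z k)) ^+ d.
  rewrite -lee_fin; apply: le_trans (volume_level_count k (leqnn T)).
  apply: (volume_minkowski_ball_ge (ltW z0) (knowledge_set_hidden (leqnn T))).
  by apply: closed_row_measurable; apply: minkowski_ball_closed; exact: knowledge_set_compact.
move: (z k) (level_count k T) zE z0 lower_upper => c N cE c0.
(* Compares the sides of the outer and inner cubes. As [c] is [1 / (4 * d%:R * 2 ^+ k)], the
   right-hand side equals 4, and [c <= 1] suffices. *)
have ratio : 2 * (1 + c) <= 2 * c / d%:R * (2 ^+ k.+3 * d%:R ^+ 2).
  have -> : 2 * c / d%:R * (2 ^+ k.+3 * d%:R ^+ 2) = 4.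
    by rewrite cE !exprS; field; rewrite gt_eqF// gt_eqF.
  suff : c <= 1 by lra.
  rewrite cE ler_pdivrMr ?mulr_gt0// mul1r ler_pdivrMr//.
  by nra.
move=> lower_upper.
have count : (6 / 5) ^+ N <= (2 ^+ k.+3 * d%:R ^+ 2) ^+ d :> R.
  have b0 : 0 < (2 * c / d%:R) ^+ d by rewrite exprn_gt0// divr_gt0 ?mulr_gt0.
  rewrite -(ler_pM2l b0) -exprMn.
  have h : (2 * (1 + c)) ^+ d <= (2 * c / d%:R * (2 ^+ k.+3 * d%:R ^+ 2)) ^+ d.
    have c2 : 0 <= 2 * (1 + c) by lra.
    by apply: lerXn2r => //; rewrite nnegrE// (le_trans c2).
  apply: le_trans h.
  have -> : (6 / 5) ^+ N = ((5 / 6) ^+ N)^-1 :> R by rewrite -exprVn; congr (_ ^+ _); field.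
  by rewrite ler_pdivrMr ?exprn_gt0 ?divr_gt0// [leRHS]mulrC.
have base0 : 0 < 6 / 5 :> R by lra.
have ratio0 : 0 < 2 ^+ k.+3 * d%:R ^+ 2 :> R by rewrite mulr_gt0// exprn_gt0.
have : ln ((6 / 5) ^+ N) <= ln ((2 ^+ k.+3 * d%:R ^+ 2) ^+ d) :> R.
  by rewrite ler_ln// posrE exprn_gt0.
rewrite !lnXn// lnM ?posrE ?exprn_gt0// !lnXn//.
by rewrite -[leLHS]mulr_natl -[leRHS]mulr_natl -(mulr_natr (ln 2)) -(mulr_natl (ln d%:R)).
Qed.

Lemma search_loss :
  \sum_(t < T) `|y t - dot v0 (x t)| <=
  d%:R * (32 * ln 2 + 16 * ln d%:R) / ln (6 / 5).
Proof.
have l0 : 0 < ln (6 / 5) :> R by rewrite ln_gt0//; lra.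
(* Level 0 is a default value beyond the horizon and for rounds of zero width. *)
have lev t : exists k, (t < T)%N -> width (S t) (x t) != 0 -> round_level t k.
  have [tT|tT] := boolP (t < T)%N; last by exists 0%N.
  have [w0|w0] := eqVneq (width (S t) (x t)) 0; first by exists 0%N.
  by have [k kP] := round_level_exists tT w0; exists k.
have [lv lvP] := choice lev.
(* This exceeds every chosen level, so finitely many levels cover all rounds. *)
pose M := (\sum_(t < T) lv t).+1.
have lossM (t : 'I_T) : `|y t - dot v0 (x t)| <=
    \sum_(k < M) `[< round_level t k >]%:R * (4 / 2 ^+ k).
  have [w0|w0] := eqVneq (width (S t) (x t)) 0.
    rewrite (zero_width_loss (ltn_ord t) w0) subrr normr0.
    by apply: sumr_ge0 => k _; rewrite mulr_ge0// divr_ge0// exprn_ge0.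
  have lt_M : (lv t < M)%N by rewrite ltnS (bigD1 t)//= leq_addr.
  have level_t := lvP t (ltn_ord t) w0.
  (* The term of the chosen level already bounds the loss; the others are nonnegative. *)
  rewrite (bigD1 (Ordinal lt_M))//= asboolT// mul1r.
  apply: (le_trans (round_level_loss (ltn_ord t) level_t)).
  by rewrite lerDl sumr_ge0// => k _; rewrite mulr_ge0// divr_ge0// exprn_ge0.
apply: (@le_trans _ _ (\sum_(t < T) \sum_(k < M) `[< round_level t k >]%:R * (4 / 2 ^+ k))).
  exact: ler_sum.
(* Summing over rounds first turns the inner sum into [level_count k T]. *)
rewrite exchange_big /=.
apply: (@le_trans _ _ (\sum_(k < M) 4 * d%:R / ln (6 / 5) *
    ((ln 2 * k.+3%:R + 2 * ln d%:R) / 2 ^+ k))).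
  apply: ler_sum => k _; rewrite -mulr_suml -natr_sum -/(level_count k T).
  have := level_count_le k; rewrite -ler_pdivlMr// => h.
  have k0 : 0 < 4 / 2 ^+ k :> R by rewrite divr_gt0// exprn_gt0.
  apply: (le_trans (ler_wpM2r (ltW k0) h)).
  by rewrite le_eqVlt; apply/orP; left; apply/eqP; ring.
rewrite -mulr_sumr.
have lnd : 0 <= 2 * ln d%:R :> R by rewrite mulr_ge0// ln_ge0// ler1n.
have ln2 : 0 <= ln 2 :> R by rewrite ln_ge0// ler1n.
have c0 : 0 <= 4 * d%:R / ln (6 / 5) :> R by rewrite divr_ge0// ltW.
apply: le_trans (ler_wpM2l c0 (sum_linear_geometric_le M ln2 lnd)) _.
by rewrite le_eqVlt; apply/orP; left; apply/eqP; ring.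
Qed.

End search.

(** At [d = 1] the quantity [d%:R * ln d%:R] vanishes, so that case is bounded by the constant
    alone. *)
Theorem mainTheorem1 (R : realType) :
  exists2 C : R, 0 < C &
  forall (d T : nat) (v0 : 'rV[R]_d)
    (x : nat -> 'rV[R]_d) (y sigma : nat -> R),
    (1 <= d)%N -> (1 <= T)%N ->
    unit_ball v0 ->
    (forall t : nat, (t < T)%N -> unit_ball (x t)) ->
    (forall t : nat, (t < T)%N ->
       valid_feedback (dot v0 (x t)) (y t) (sigma t)) ->
    (forall t : nat, (t < T)%N ->
       msp_guess (knowledge_set x y sigma t) (x t) (y t)) ->
    let loss := \sum_(t < T) `|y t - dot v0 (x t)| in
    ((2 <= d)%N -> loss <= C * (d%:R * ln d%:R)) /\
    (d = 1%N -> loss <= C).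
Proof.
have l0 : 0 < ln (6 / 5) :> R by rewrite ln_gt0//; lra.
(* For [d >= 2], [ln 2 <= ln d%:R] gives [32 * ln 2 + 16 * ln d%:R <= 48 * ln d%:R]; for [d = 1],
   [ln 2 < 2] gives [32 * ln 2 < 64]. *)
exists (64 / ln (6 / 5)); first by rewrite divr_gt0.
move=> d T v0 x y sigma d1 _ v01 x1 feedback guess loss.
have := search_loss d1 v01 x1 feedback guess; rewrite -/loss => lossP.
have ln2 : 0 < ln 2 :> R by rewrite ln_gt0// ltr1n.
split => [d2|dE]; apply: (le_trans lossP).
  have dR : 0 < d%:R :> R by rewrite ltr0n.
  have lnd : ln 2 <= ln d%:R :> R by rewrite ler_ln ?posrE// ler_nat.
  rewrite [leRHS]mulrAC ler_pM2r ?invr_gt0// [leRHS]mulrCA ler_pM2l//.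
  lra.
rewrite dE ln1 mulr0 addr0 mul1r ler_pM2r ?invr_gt0//.
have : ln 2 < 2 :> R by exact: ln_sublinear.
lra.
Qed.
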